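(* Let $\mathcal R=\langle S\mid R\rangle$ be a finitely presented rack with $S=\{x_1,\dots,x_g\}$ and let $M$ be a positive integer. If ENUMERATE$(S,R,M)$ completes, then the returned table $\mathcal E=(\omega,A,\tau,\rho)$, with set of live elements $\Omega$, is complete and satisfies the following five properties: (1) $1\in\Omega$ and $\tau(i)=x_i$ for all $1\le i\le g$. (2) If $i,j\in\{1,\dots,\omega\}$ and $y\in S\cup\bar S$, then $i^y=j$ if and only if $j^{\bar y}=i$. (3) If $i,j\in\{1,\dots,\omega\}$, $y\in S\cup\bar S$ and $i^y=j$, then $\tau(i)^y=\tau(j)$ in $\mathcal R$. (4) If $j\in\Omega$, then there exist $i\in\Omega$ with $1\le i\le g$ and $w\in F(S)$ such that $j=i^w$. (5) If $i\in\{1,\dots,\omega\}$, then $\tau(i)=\tau(\mathrm{REP}(i))$ in $\mathcal R$.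
   Context: RACKS AND PRESENTATIONS. A rack is a set with two binary operations $\rhd,\rhd^{-1}$ such that $(x\rhd y)\rhd^{-1}y=(x\rhd^{-1}y)\rhd y=x$ and $(x\rhd y)\rhd z=(x\rhd z)\rhd(y\rhd z)$ for all $x,y,z$. Write $x^y=x\rhd y$, $x^{\bar y}=x\rhd^{-1}y$; a word in the exponent acts letter by letter from left to right. $F(S)$ is the free group on $S$, and $\bar w$ denotes the inverse of $w\in F(S)$; $\bar S=\{\bar x: x\in S\}$. The free rack $FR(S)$ is the set of symbols $a^w$ ($a\in S$, $w\in F(S)$), with $a^u=b^v$ iff $a=b$ in $S$ and $u=v$ in $F(S)$, and operations $a^u\rhd b^v=a^{u\bar v b v}$, $a^u\rhd^{-1}b^v=a^{u\bar v\bar b v}$. Given $S=\{x_1,\dots,x_g\}$ ($g\ge1$) and a finite set $R$ of pairs $(x_i^{u},x_j)$, written $x_i^u=x_j$, with $x_i,x_j\in S$ and $u$ a reduced word in $F(S)$ (primary relations), $\mathcal R=\langle S\mid R\rangle$ is the quotient of $FR(S)$ by the smallest congruence (equivalence relation respecting both operations) containing $R$. TABLES. An enumeration table for $\mathcal R$ is $\mathcal E=(\omega,A,\tau,\rho)$, where $\omega$ is the number of rows, $A$ is a partial function $\{1,\dots,\omega\}\times(S\cup\bar S)\to\{1,\dots,\omega\}$ (write $i^y$ for $A(i,y)$, possibly undefined), $\tau:\{1,\dots,\omega\}\to\mathcal R$ and $\rho:\{1,\dots,\omega\}\to\{1,\dots,\omega\}$ are functions, and $\rho(i)\le i$ for all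 $i$. For a word $w=y_1\cdots y_t$, $j^w=k$ means that the successive entries $j_0=j$, $j_s=j_{s-1}^{y_s}$ are all defined and $j_t=k$. The live elements are $\Omega=\{i:\rho(i)=i\}$ (always with respect to the current $\rho$). $\mathcal E$ is complete if $i^y$ is defined for all $i\in\Omega$, $y\in S\cup\bar S$. REP$(i)$ is the least element of $\{\rho^t(i):t\ge0\}$, obtained by iterating $\rho$ until a fixed point is reached. ALGORITHMS (all act on the current table; loops over $R$, $R_2$, $S\cup\bar S$ use fixed orders, not depending on $M$). INIT: $\omega:=g$, $A$ empty, $\tau(i):=x_i$ and $\rho(i):=i$ for $1\le i\le g$; $R_2$ (secondary relations) is the set of reduced forms of the words $\bar u x_i u\bar x_j$ for $x_i^u=x_j$ in $R$. DEFINE$(i,y)$: $\omega:=\omega+1$; $i^y:=\omega$; $\omega^{\bar y}:=i$; $\tau(\omega):=\tau(i)^y$; $\rho(\omega):=\omega$. DEDUCTION$(i,y,j)$: $i^y:=j$; $j^{\bar y}:=i$. SCAN$(i,w,j)$ with $w=y_1\cdots y_t$ reduced: set $f:=1$, $b:=t$, $k:=i$, $\ell:=j$. Repeat: while $f\le b$ and $k^{y_f}$ is defined, set $k:=k^{y_f}$, $f:=f+1$; then while $f\le b$ and $\ell^{\bar y_b}$ is defined, set $\ell:=\ell^{\bar y_b}$, $b:=b-1$. If $f<b$, call DEFINE$(k,y_f)$ and repeat; if $f=b$, call DEDUCTION$(k,y_f,\ell)$ and stop; if $f>b$ and $k\ne\ell$, call COINCIDENCE$(k,\ell)$ and stop;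 if $f>b$ and $k=\ell$, stop. UPDATE$(i)$: set $\rho(j):=$ REP$(i)$ for all $j$ in $\{\rho^t(i):t\ge0\}$. MERGE$(m,n)$ (with a queue $Q$): $\mu:=$ REP$(m)$, $\nu:=$ REP$(n)$; if $\mu\ne\nu$, append $\max(\mu,\nu)$ to $Q$ and set $\rho(\max(\mu,\nu)):=\min(\mu,\nu)$. COINCIDENCE$(m,n)$: let $Q$ be empty; call MERGE$(m,n)$. Process the elements $d$ of $Q$ in order (including those appended meanwhile) until all are processed: for each $x\in S\cup\bar S$, if $d^x$ is defined, say $d^x=e$, then: undefine $d^x$ and $e^{\bar x}$; set $\delta:=$ REP$(d)$, UPDATE$(d)$; $\epsilon:=$ REP$(e)$, UPDATE$(e)$; if $\delta^x$ is defined, MERGE$(\epsilon,\delta^x)$; else if $\epsilon^{\bar x}$ is defined, MERGE$(\delta,\epsilon^{\bar x})$; else set $\delta^x:=\epsilon$, $\epsilon^{\bar x}:=\delta$. ENUMERATE$(S,R,M)$: run INIT. For each $x_i^u=x_j$ in $R$, call SCAN$($REP$(i),u,$REP$(j))$. Set $i:=1$. While $i\le\max(\Omega)$ and $i\le M$: (1) for each $w\in R_2$, if $i\in\Omega$ call SCAN$(i,w,i)$, otherwise break off this loop; (2) if $i\in\Omega$, for each $y\in S\cup\bar S$ with $i^y$ undefined call DEFINE$(i,y)$; (3) $i:=i+1$. After the loop, if $i>\max(\Omega)$ return $\mathcal E$ (then the process is said to complete); otherwise return ''run limit exceeded''. *)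

(* Defs.v *)
From HB Require Import structures.
From mathcomp Require Import all_boot.
From mathcomp Require Import generic_quotient.
From mathcomp Require Import boolp.

Set Implicit Arguments.
Unset Strict Implicit.
Unset Printing Implicit Defensive.

Local Open Scope group_scope.
Local Open Scope quotient_scope.

(* A letter (x, false) stands for x in S, and (x, true) for its formal inverse. *)
Notation letter S := (S * bool)%type.

Definition bar (S : Type) (y : letter S) : letter S := (y.1, ~~ y.2).

Definition winv (S : Type) (w : seq (letter S)) : seq (letter S) :=
  rev (map (@bar S) w).

Section Words.
Variable S : choiceType.
Implicit Types (x y z : letter S) (u v w : seq (letter S)).

Definition reduced w : bool := sorted (fun y z => z != bar y) w.

Definition red_cons y w : seq (letter S) :=
  if w is z :: w' then if z == bar y then w' else y :: w else [:: y].

Definition reduce w : seq (letter S) := foldr red_cons [::] w.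

Lemma barK : involutive (@bar S).
Proof. by case=> a b; rewrite /bar /= negbK. Qed.

Lemma winvK : involutive (@winv S).
Proof. by move=> w; rewrite /winv map_rev revK mapK //; apply: barK. Qed.

Lemma winv_cons y w : winv (y :: w) = rcons (winv w) (bar y).
Proof. by rewrite /winv /= rev_cons. Qed.

Lemma reduced_tl y w : reduced (y :: w) -> reduced w.
Proof. exact: path_sorted. Qed.

Lemma red_cons_reduced y w : reduced w -> reduced (red_cons y w).
Proof.
case: w => [|z w] //= rw; case: ifP => [_|/negbT zy]; first exact: path_sorted rw.
by rewrite /reduced /= zy.
Qed.

Lemma foldr_reduced u w : reduced w -> reduced (foldr red_cons w u).
Proof. by move=> rw; elim: u => //= y u; apply: red_cons_reduced. Qed.

Lemma reduce_reduced w : reduced (reduce w).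
Proof. exact: foldr_reduced. Qed.

Lemma red_consK y w :
  reduced w -> red_cons (bar y) (red_cons y w) = w.
Proof.
case: w => [|z w] rw /=; first by rewrite barK eqxx.
case: ifP => [/eqP zy|_] /=; last by rewrite barK eqxx.
move: rw; rewrite zy; case: w => [|z2 w] //=.
by rewrite /reduced /= => /andP[/negbTE -> _].
Qed.

Lemma red_consVK y w :
  reduced w -> red_cons y (red_cons (bar y) w) = w.
Proof. by move=> rw; rewrite -{1}(barK y) red_consK. Qed.

Lemma reduce_id w : reduced w -> reduce w = w.
Proof.
elim: w => //= y w IH rw; rewrite IH; last exact: reduced_tl rw.
case: w rw {IH} => //= z w; rewrite /reduced /= => /andP[/negbTE -> _].
by [].
Qed.

Lemma foldr_red_cons y u w : reduced w ->
  foldr red_cons w (red_cons y u)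
  = red_cons y (foldr red_cons w u).
Proof.
move=> rw; case: u => [|z u] //=; case: ifP => // /eqP -> /=.
by rewrite red_consVK // foldr_reduced.
Qed.

Lemma foldr_reduce u w : reduced w ->
  foldr red_cons w (reduce u) = foldr red_cons w u.
Proof.
by move=> rw; elim: u => //= y u IH; rewrite foldr_red_cons ?IH.
Qed.

Lemma reduce_cat u v : reduce (u ++ v) = foldr red_cons (reduce v) u.
Proof. by rewrite /reduce foldr_cat. Qed.

Lemma foldr_winv u w : reduced w ->
  foldr red_cons (foldr red_cons w u) (winv u) = w.
Proof.
move=> rw; elim: u => //= y u IH.
by rewrite winv_cons foldr_rcons red_consK ?IH // foldr_reduced.
Qed.

Lemma winv_reduced w : reduced w -> reduced (winv w).
Proof.
rewrite /reduced /winv rev_sorted sorted_map.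
apply: sub_sorted => y z; apply: contraNN => /eqP /=.
by move=> ->; rewrite barK.
Qed.

End Words.

Record free_group (S : choiceType) := FreeGroup {
  fg_word :> seq (letter S);
  fg_wordP : reduced fg_word
}.

Section FreeGroup.
Variable S : choiceType.

HB.instance Definition _ := [isSub for @fg_word S].
HB.instance Definition _ := [Choice of free_group S by <:].

Implicit Types u v w : free_group S.

Definition fg_reduce (w : seq (letter S)) : free_group S :=
  FreeGroup (reduce_reduced w).
Definition fg_one : free_group S := fg_reduce [::].
Definition fg_mul u v : free_group S := fg_reduce (u ++ v).
Definition fg_inv u : free_group S := FreeGroup (winv_reduced (fg_wordP u)).

Lemma fg_mulE u v : fg_word (fg_mul u v) = foldr (@red_cons S) v u.
Proof. by rewrite /= reduce_cat (reduce_id (fg_wordP v)). Qed.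

Fact fg_mulA : associative fg_mul.
Proof.
move=> u v w; apply: val_inj; rewrite -![val _]/(fg_word _).
rewrite [LHS]fg_mulE [RHS]fg_mulE fg_mulE.
by rewrite -[fg_word (fg_mul u v)]/(reduce (u ++ v)) foldr_reduce ?foldr_cat ?fg_wordP.
Qed.

Fact fg_mul1 : left_id fg_one fg_mul.
Proof. by move=> u; apply: val_inj; rewrite /= reduce_id // fg_wordP. Qed.

Fact fg_mulr1 : right_id fg_one fg_mul.
Proof. by move=> u; apply: val_inj; rewrite /= cats0 reduce_id // fg_wordP. Qed.

Fact fg_mulV : left_inverse fg_one fg_inv fg_mul.
Proof.
move=> u; apply: val_inj; rewrite -[val _]/(fg_word _) fg_mulE /=.
by rewrite -{1}(reduce_id (fg_wordP u)) foldr_winv.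
Qed.

Fact fg_mulrV : right_inverse fg_one fg_inv fg_mul.
Proof.
move=> u; rewrite -{1}(_ : fg_inv (fg_inv u) = u) ?fg_mulV //.
by apply: val_inj; rewrite /= winvK.
Qed.

HB.instance Definition _ :=
  isGroup.Build (free_group S) fg_mulA fg_mul1 fg_mulr1 fg_mulV fg_mulrV.

Definition fg_gen (x : S) : free_group S := fg_reduce [:: (x, false)].

End FreeGroup.

HB.mixin Record isRack T := {
  rk : T -> T -> T;
  rkV : T -> T -> T;
  rkK : forall x y, rkV (rk x y) y = x;
  rkVK : forall x y, rk (rkV x y) y = x;
  rk_dist : forall x y z, rk (rk x y) z = rk (rk x z) (rk y z)
}.

#[short(type="rackType")]
HB.structure Definition Rack := {T of isRack T & Choice T}.

(* The pair (a, w) is the symbol a^w, with equality that of S and F(S). *)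
Definition free_rack (S : choiceType) : Type := (S * free_group S)%type.

Section FreeRack.
Variable S : choiceType.

HB.instance Definition _ := Choice.on (free_rack S).

Definition fr_op (p q : free_rack S) : free_rack S :=
  (p.1, p.2 * q.2^-1 * fg_gen q.1 * q.2).
Definition fr_opV (p q : free_rack S) : free_rack S :=
  (p.1, p.2 * q.2^-1 * (fg_gen q.1)^-1 * q.2).

Fact fr_opK p q : fr_opV (fr_op p q) q = p.
Proof. by case: p => a u; rewrite /fr_op /fr_opV /= !(mulgK, mulgVK). Qed.

Fact fr_opVK p q : fr_op (fr_opV p q) q = p.
Proof. by case: p => a u; rewrite /fr_op /fr_opV /= !(mulgK, mulgVK). Qed.

Fact fr_op_dist p q r : fr_op (fr_op p q) r = fr_op (fr_op p r) (fr_op q r).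
Proof.
rewrite /fr_op /=; congr (_, _).
by rewrite !invgM !invgK !mulgA !(mulgK, mulgVK).
Qed.

HB.instance Definition _ := isRack.Build (free_rack S) fr_opK fr_opVK fr_op_dist.

Definition fr_gen (x : S) : free_rack S := (x, 1).

End FreeRack.

Inductive congr_closure (T : rackType) (P : T -> T -> Prop) : T -> T -> Prop :=
| CongrBase x y of P x y : congr_closure P x y
| CongrRefl x : congr_closure P x x
| CongrSym x y of congr_closure P x y : congr_closure P y x
| CongrTrans y x z of congr_closure P x y & congr_closure P y z :
    congr_closure P x z
| CongrOp x x' y y' of congr_closure P x x' & congr_closure P y y' :
    congr_closure P (rk x y) (rk x' y')
| CongrOpV x x' y y' of congr_closure P x x' & congr_closure P y y' :
    congr_closure P (rkV x y) (rkV x' y').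

(* The triple (a, u, b) is the primary relation a^u = b. *)
Notation primary_rel S := (S * free_group S * S)%type.

Section PresentedRack.
Variables (S : choiceType) (R : seq (primary_rel S)).

Inductive rel_pair : free_rack S -> free_rack S -> Prop :=
| RelPair a u b of (a, u, b) \in R : rel_pair (a, u) (fr_gen b).

Definition pres_rel : rel (free_rack S) :=
  fun p q => `[< congr_closure rel_pair p q >].

Fact pres_rel_refl : reflexive pres_rel.
Proof. by move=> p; apply/asboolP; apply: CongrRefl. Qed.

Fact pres_rel_sym : symmetric pres_rel.
Proof. by move=> p q; apply/asboolP/asboolP; apply: CongrSym. Qed.

Fact pres_rel_trans : transitive pres_rel.
Proof.
by move=> q p r /asboolP pq /asboolP qr; apply/asboolP; apply: CongrTrans qr.
Qed.

Canonical pres_equiv := EquivRel pres_rel pres_rel_refl pres_rel_sym pres_rel_trans.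

Definition pres_rack : Type := {eq_quot pres_equiv}.

HB.instance Definition _ := Choice.on pres_rack.
HB.instance Definition _ := EqQuotient.on pres_rack.

Definition pr_class (p : free_rack S) : pres_rack := \pi_pres_rack p.

Lemma pr_classP p q : pr_class p = pr_class q <-> congr_closure rel_pair p q.
Proof.
split=> [/eqP|pq]; first by rewrite eqmodE => /asboolP.
by apply/eqP; rewrite eqmodE; apply/asboolP.
Qed.

Lemma pr_reprK (x : pres_rack) : pr_class (repr x) = x.
Proof. exact: reprK. Qed.

Definition pr_op (x y : pres_rack) : pres_rack := pr_class (rk (repr x) (repr y)).
Definition pr_opV (x y : pres_rack) : pres_rack := pr_class (rkV (repr x) (repr y)).

Lemma pr_opE p q : pr_op (pr_class p) (pr_class q) = pr_class (rk p q).
Proof. by apply/pr_classP; apply: CongrOp; apply/pr_classP; rewrite pr_reprK. Qed.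

Lemma pr_opVE p q : pr_opV (pr_class p) (pr_class q) = pr_class (rkV p q).
Proof. by apply/pr_classP; apply: CongrOpV; apply/pr_classP; rewrite pr_reprK. Qed.

Fact pr_opK x y : pr_opV (pr_op x y) y = x.
Proof. by rewrite -[x]pr_reprK -[y]pr_reprK pr_opE pr_opVE rkK. Qed.

Fact pr_opVK x y : pr_op (pr_opV x y) y = x.
Proof. by rewrite -[x]pr_reprK -[y]pr_reprK pr_opVE pr_opE rkVK. Qed.

Fact pr_op_dist x y z : pr_op (pr_op x y) z = pr_op (pr_op x z) (pr_op y z).
Proof.
by rewrite -[x]pr_reprK -[y]pr_reprK -[z]pr_reprK !pr_opE rk_dist.
Qed.

HB.instance Definition _ := isRack.Build pres_rack pr_opK pr_opVK pr_op_dist.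

Definition pr_gen (x : S) : pres_rack := pr_class (fr_gen x).

Definition pr_exp (t : pres_rack) (y : letter S) : pres_rack :=
  if y.2 then rkV t (pr_gen y.1) else rk t (pr_gen y.1).

Definition secondary_rel (r : primary_rel S) : free_group S :=
  let: (a, u, b) := r in u^-1 * fg_gen a * u * (fg_gen b)^-1.

End PresentedRack.

(* Rows are the numbers 1, ..., nrows; the values of act, tau and rho at other *)
(* indices are irrelevant.                                                     *)
Record table (L T : Type) := Table {
  nrows : nat;
  act : nat -> L -> option nat;
  tau : nat -> T;
  rho : nat -> nat
}.

Section Tables.
Variables (S : choiceType) (T : Type).
Implicit Types (E : table (letter S) T) (i j k : nat).

Definition is_row E i : bool := 0 < i <= nrows E.

Definition is_table E : Prop :=
  (forall i y j, act E i y = Some j -> is_row E i /\ is_row E j) /\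
  (forall i, is_row E i -> is_row E (rho E i) /\ rho E i <= i).

Definition live E i : bool := is_row E i && (rho E i == i).

Definition max_live E : nat := \max_(1 <= i < (nrows E).+1 | live E i) i.

Definition complete E : Prop :=
  forall i y, live E i -> exists j, act E i y = Some j.

(* Since rho i <= i, a fixed point is reached after at most i steps: see repP. *)
Definition rep E i : nat := iter i (rho E) i.

Definition rho_orbit E i : seq nat := traject (rho E) i i.+1.

Lemma repP E i : (forall j, rho E j <= j) ->
  [/\ rho E (rep E i) = rep E i, rep E i \in rho_orbit E i
    & forall t, rep E i <= iter t (rho E) i].
Proof.
move=> le_rho.
have decr t : iter t.+1 (rho E) i <= iter t (rho E) i by apply: le_rho.
have decrD t s : iter (t + s) (rho E) i <= iter t (rho E) i.
  by elim: s => [|s IH]; rewrite ?addn0 // addnS; apply: leq_trans (decr _) IH.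
have [t le_ti fix_t] : exists2 t, t <= i & iter t.+1 (rho E) i = iter t (rho E) i.
  have [/existsP[t /eqP fix_t]|/existsPn nofix] :=
    boolP [exists t : 'I_i.+1, iter t.+1 (rho E) i == iter t (rho E) i].
    by exists t; rewrite // -ltnS.
  have bnd t : t <= i.+1 -> iter t (rho E) i + t <= i.
    elim: t => [|t IH] lt_ti; first by rewrite addn0.
    apply: leq_trans (IH (ltnW lt_ti)); rewrite addnS ltn_add2r.
    by rewrite ltn_neqAle decr andbT; apply: (nofix (Ordinal lt_ti)).
  by have := bnd _ (leqnn _); rewrite addnS ltnNge leq_addl.
have stay s : iter (t + s) (rho E) i = iter t (rho E) i.
  by elim: s => [|s IH]; rewrite ?addn0 // addnS iterS IH -iterS.
have repE : rep E i = iter t (rho E) i by rewrite /rep -{1}(subnKC le_ti) stay.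
split; first by rewrite repE -iterS.
  by apply/trajectP; exists i.
move=> s; rewrite repE; have [le_st|lt_ts] := leqP s t.
  by rewrite -(subnKC le_st); apply: decrD.
by rewrite -(subnKC (ltnW lt_ts)) stay.
Qed.

Lemma rho_orbitP E i j : (forall k, rho E k <= k) ->
  reflect (exists t, j = iter t (rho E) i) (j \in rho_orbit E i).
Proof.
move=> le_rho; apply: (iffP trajectP) => [[t _ ->]|[t ->]]; first by exists t.
have [lt_ti|le_it] := ltnP t i.+1; first by exists t.
exists i => //; have [fix_rep _ _] := repP i le_rho.
rewrite -(subnK (ltnW le_it)) iterD -/(rep E i).
by elim: (t - i) => //= s ->.
Qed.

(* trace E i w = Some j is the relation i^w = j. *)
Definition trace E i (w : seq (letter S)) : option nat :=
  foldl (fun oi y => obind (fun k => act E k y) oi) (Some i) w.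

Definition set_act E i (y : letter S) (o : option nat) :=
  Table (nrows E)
        (fun k z => if (k == i) && (z == y) then o else act E k z)
        (tau E) (rho E).

Definition set_rho E (P : pred nat) i :=
  Table (nrows E) (act E) (tau E) (fun k => if P k then i else rho E k).

Definition add_row E (t : T) :=
  let n := (nrows E).+1 in
  Table n (act E)
        (fun k => if k == n then t else tau E k)
        (fun k => if k == n then n else rho E k).

Definition deduction E i y j := set_act (set_act E i y (Some j)) j (bar y) (Some i).

Definition undefine E i y j := set_act (set_act E i y None) j (bar y) None.

Definition update E i := set_rho E (mem (rho_orbit E i)) (rep E i).

Definition merge (EQ : table (letter S) T * seq nat) m n :=
  let: (E, Q) := EQ in
  let mu := rep E m in let nu := rep E n in
  if mu == nu then (E, Q)
  else (set_rho E (pred1 (maxn mu nu)) (minn mu nu), rcons Q (maxn mu nu)).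

Definition process_letter d (EQ : table (letter S) T * seq nat) x :=
  let: (E, Q) := EQ in
  if act E d x is Some e then
    let E1 := undefine E d x e in
    let delta := rep E1 d in
    let E2 := update E1 d in
    let eps := rep E2 e in
    let E3 := update E2 e in
    if act E3 delta x is Some k then merge (E3, Q) eps k
    else if act E3 eps (bar x) is Some k then merge (E3, Q) delta k
    else (deduction E3 delta x eps, Q)
  else EQ.

(* Loops whose length is not bounded in advance take a fuel argument and return *)
(* None when it runs out; [completes] below asks for some sufficient fuel.      *)
(* Y is the fixed order on S and its formal inverses used by the loops. *)
Variable Y : seq (letter S).

(* Processed elements are removed from the front of the queue. *)
Fixpoint process_queue fuel (EQ : table (letter S) T * seq nat) :=
  let: (E, Q) := EQ in
  if Q is d :: Q' then
    if fuel is f.+1 then process_queue f (foldl (process_letter d) (E, Q') Y)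
    else None
  else Some E.

Definition coincidence fuel E m n := process_queue fuel (merge (E, [::]) m n).

End Tables.

Section Enumeration.
Variables (S : choiceType) (R : seq (primary_rel S)).
Variables (R2 : seq (free_group S)) (Y : seq (letter S)).
Implicit Types (E : table (letter S) (pres_rack R)) (i k l : nat).

Definition define E i y :=
  deduction (add_row E (pr_exp (tau E i) y)) i y (nrows E).+1.

(* The forward loop of a scan: the row reached and the unread part of w.        *)
Fixpoint follow E k (w : seq (letter S)) : nat * seq (letter S) :=
  if w is y :: w' then
    if act E k y is Some k' then follow E k' w' else (k, w)
  else (k, [::]).

(* v is the part y_f ... y_b of the scanned word. The backward loop is the      *)
(* forward loop from l along the inverse of v.                                 *)
Fixpoint scan fuel E k (v : seq (letter S)) l :=
  if fuel is f.+1 then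
    let: (k', v1) := follow E k v in
    let: (l', v2) := follow E l (winv v1) in
    let v' := winv v2 in
    match v' with
    | [::] => if k' == l' then Some E else coincidence Y f E k' l'
    | [:: y] => Some (deduction E k' y l')
    | y :: _ => scan f (define E k' y) k' v' l'
    end
  else None.

Fixpoint scan_secondary fuel E i (ws : seq (free_group S)) :=
  if ws is w :: ws' then
    if live E i then
      obind (fun E' => scan_secondary fuel E' i ws') (scan fuel E i w i)
    else Some E
  else Some E.

Definition fill_row E i :=
  if live E i then
    foldl (fun E' y => if act E' i y is None then define E' i y else E') E Y
  else E.

Inductive outcome :=
| Completed of table (letter S) (pres_rack R)
| RunLimitExceeded.

Fixpoint main_loop fuel M E i : option outcome :=
  if (i <= max_live E) && (i <= M) then
    if fuel is f.+1 then
      obind (fun E' => main_loop f M (fill_row E' i) i.+1)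
            (scan_secondary f E i R2)
    else None
  else Some (if max_live E < i then Completed E else RunLimitExceeded).

End Enumeration.

Section Enumerate.
(* The generators x_1, ..., x_g are the elements of 'I_n.+1, so g = n.+1, and  *)
(* x_i is the ordinal of value i - 1.                                          *)
Variables (n : nat) (R : seq (primary_rel 'I_n.+1)).
Variables (R2 : seq (free_group 'I_n.+1)) (Y : seq (letter 'I_n.+1)).

Definition gen_row (a : 'I_n.+1) : nat := a.+1.

Definition init : table (letter 'I_n.+1) (pres_rack R) :=
  Table n.+1 (fun _ _ => None) (fun i => pr_gen R (inord i.-1)) id.

Fixpoint scan_primary fuel (E : table (letter 'I_n.+1) (pres_rack R))
    (rs : seq (primary_rel 'I_n.+1)) :=
  if rs is (a, u, b) :: rs' then
    obind (fun E' => scan_primary fuel E' rs')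
          (scan Y fuel E (rep E (gen_row a)) u (rep E (gen_row b)))
  else Some E.

Definition enumerate fuel M : option (outcome R) :=
  obind (fun E => main_loop R2 Y fuel M E 1) (scan_primary fuel init R).

Definition completes M (E : table (letter 'I_n.+1) (pres_rack R)) : Prop :=
  exists fuel, enumerate fuel M = Some (Completed E).

End Enumerate.

(* Main.v *)
Require Import Defs.
From mathcomp Require Import all_boot.

(** Every step of the procedure only adds information about the presented rack,
    and what is known is best measured up to the equivalence [rep E i = rep E j]
    on rows, since a coincidence moves entries from a row to its representative.

    Say that [i] and [j] are joined by a class edge labelled [y] if some row
    equivalent to [i] has entry [y] equivalent to [j] ([class_edge]).  Each
    operation sends a table [E] to a table [E'] that [extends] it: old rows keep
    their images in the rack, equivalent rows stay equivalent and class edges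
    persist.  For a coincidence this is the content of [wf_process_letter]: an
    entry [d^x = e] of a dead row is removed, but whichever of the three branches
    is taken, the representatives of [d] and [e] are joined by [x] afterwards,
    possibly thanks to a new identification.

    The invariant [wf] collects what holds for a table in the middle of a
    coincidence.  Apart from symmetry of the entries and their agreement with
    the rack, it says that a row bearing an entry is live unless it still awaits
    processing.  Scans respect the agreement with the rack because the words they
    read do connect the images of their end rows: a primary relation holds by
    construction ([word_act_primary]), and a secondary relation acts trivially
    on the whole rack ([word_act_secondary]).  When the queue
    is empty all entries therefore join live rows, which are their own
    representatives, so class edges at live rows are actual entries
    ([settled_class_edge]).

    Completeness and connectedness are now monotone at the level of classes.
    Row [i] is filled when the main loop reaches it if it is live; otherwise its
    representative is a smaller row, which has been treated earlier
    ([evolves_main_loop]).  A row created by a definition is joined to an older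
    one, so every row is linked to a generator by entries and identifications
    ([conn]).  In the final table both statements are about live rows and actual
    entries, and a path of entries labelled [w] can be freely reduced because the
    entries are symmetric ([trace_reduce]). *)

Set Implicit Arguments.
Unset Strict Implicit.
Unset Printing Implicit Defensive.

(** * Words acting on a presented rack *)

Section WordAction.
Local Open Scope group_scope.
Variables (S : choiceType) (R : seq (primary_rel S)).
Implicit Types (t : pres_rack R) (y : letter S) (w : seq (letter S)).

Definition word_act t w : pres_rack R := foldl (@pr_exp S R) t w.

Lemma pr_expK t y : pr_exp (pr_exp t y) (bar y) = t.
Proof. by case: y => a []; rewrite /pr_exp /= ?rkK ?rkVK. Qed.

Lemma word_actK t w : word_act (word_act t w) (winv w) = t.
Proof.
elim: w t => //= y w IH t.
by rewrite winv_cons /word_act foldl_rcons [foldl _ _ (winv w)]IH pr_expK.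
Qed.

Lemma fg_reduce_cons y w : fg_reduce (y :: w) = fg_reduce [:: y] * fg_reduce w.
Proof.
apply: val_inj; rewrite -[val _]/(reduce _) -[RHS]/(reduce ([:: y] ++ reduce w)).
by rewrite reduce_cat (reduce_id (reduce_reduced w)).
Qed.

Lemma fg_reduceK (w : free_group S) : fg_reduce w = w.
Proof. by apply: val_inj; rewrite /= reduce_id // fg_wordP. Qed.

Lemma fg_gen_inv (b : S) : (fg_gen b)^-1 = fg_reduce [:: (b, true)].
Proof. exact: val_inj. Qed.

Lemma pr_exp_class a (u : free_group S) y :
  pr_exp (pr_class R (a, u)) y = pr_class R (a, u * fg_reduce [:: y]).
Proof.
have op1 z : u * (1 : free_group S)^-1 * z * 1 = u * z.
  by rewrite invg1 !mulg1.
by case: y => b []; [rewrite -fg_gen_inv|];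
  rewrite /pr_exp /pr_gen ?[LHS]pr_opE ?[LHS]pr_opVE;
  congr (pr_class R (a, _)); apply: op1.
Qed.

Lemma word_act_class a (u : free_group S) w :
  word_act (pr_class R (a, u)) w = pr_class R (a, u * fg_reduce w).
Proof.
elim: w u => [|y w IH] u /=; first by rewrite [fg_reduce _]/(1 : free_group S) mulg1.
by rewrite pr_exp_class [LHS]IH (fg_reduce_cons y w) mulgA.
Qed.

Lemma word_act_primary a (u : free_group S) b :
  (a, u, b) \in R -> word_act (pr_gen R a) u = pr_gen R b.
Proof.
move=> Rr; rewrite word_act_class fg_reduceK mul1g.
by apply/pr_classP; apply: CongrBase.
Qed.

(** In a rack, acting by [a^u] is the same as acting by the word [u^-1 a u], so
    the relation [a^u = b] makes that word act on every element as [b] does. *)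
Lemma word_act_secondary r t :
  r \in R -> word_act t (secondary_rel r) = t.
Proof.
case: r => [[a u] b] Rr; rewrite -[t]pr_reprK; case: (repr t) => c v.
rewrite word_act_class fg_reduceK /secondary_rel.
rewrite !mulgA fg_gen_inv -pr_exp_class.
have -> : pr_class R (c, v * u^-1 * fg_gen a * u)
   = pr_exp (pr_class R (c, v)) (b, false).
  rewrite -[pr_class R _]/(pr_class R (rk ((c, v) : free_rack S) (a, u))) -pr_opE.
  congr (pr_op _ _); apply/pr_classP; exact: CongrBase.
exact: (pr_expK _ (b, false)).
Qed.

End WordAction.

(** * Representatives *)

Section Representatives.
Variables (S : choiceType) (T : Type).
Implicit Types (E : table (letter S) T) (i j : nat).

Lemma rep_fix E i : rho E i = i -> rep E i = i.
Proof. by move=> fix_i; rewrite /rep; elim: {1}i => //= s ->. Qed.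

Lemma eq_rep E E' : rho E =1 rho E' -> rep E =1 rep E'.
Proof. by move=> eq_rho i; apply: eq_iter. Qed.

(** The root of [i] after a change of parents is [f] of the old root as soon
    as [f] of the old root is constant along the new parent links and new roots
    are sent to themselves; redirecting a chain to its root ([f] the identity)
    and linking a root below another one are both of this form. *)
Lemma rep_transfer E E' (f : nat -> nat) :
  (forall j, rho E' j <= j) ->
  (forall j, f (rep E (rho E' j)) = f (rep E j)) ->
  (forall j, rho E' j = j -> f (rep E j) = j) ->
  forall j, rep E' j = f (rep E j).
Proof.
move=> le_rho f_rho f_fix j; have [fix_r _ _] := repP j le_rho.
have f_iter s : f (rep E (iter s (rho E') j)) = f (rep E j).
  by elim: s => //= s IH; rewrite f_rho.
by rewrite -(f_fix _ fix_r) f_iter.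
Qed.

(** A parent chain that stops moving anywhere stops at the representative,
    whatever the number of steps. *)
Lemma rep_unique E i t :
  (forall j, rho E j <= j) -> rho E (iter t (rho E) i) = iter t (rho E) i ->
  rep E i = iter t (rho E) i.
Proof.
move=> le_rho fix_t; have [fix_r _ _] := repP i le_rho.
have stay k s : rho E k = k -> iter s (rho E) k = k.
  by move=> fix_k; elim: s => //= s ->.
by rewrite -(stay _ t fix_r) /rep -iterD addnC iterD stay.
Qed.

Lemma rep_iter E i t :
  (forall j, rho E j <= j) -> rep E (iter t (rho E) i) = rep E i.
Proof.
move=> le_rho; have [fix_r _ _] := repP (iter t (rho E) i) le_rho.
by rewrite /rep -iterD -rep_unique // iterD.
Qed.

Lemma rep_idem E i : (forall j, rho E j <= j) -> rep E (rep E i) = rep E i.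
Proof. by move=> /(repP i)[fix_r _ _]; rewrite rep_fix. Qed.

Lemma rep_update E i :
  (forall j, rho E j <= j) ->
  (forall j, rho (update E i) j <= j) /\ rep (update E i) =1 rep E.
Proof.
move=> le_rho; have [fix_r _ min_r] := repP i le_rho.
have le_rho' j : rho (update E i) j <= j.
  by rewrite /=; case: (rho_orbitP i j le_rho) => // -[t ->].
split=> // j; apply: (@rep_transfer _ _ id) => // {}j /=.
  case: (rho_orbitP i j le_rho) => [[t ->]|_]; last exact: (rep_iter j 1).
  by rewrite rep_idem // rep_iter.
case: (rho_orbitP i j le_rho) => [_ <-|_ /rep_fix //].
exact: rep_idem.
Qed.

(** Linking the root [m] below the smaller root [k] merges their two classes. *)
Lemma rep_redirect E m k :
  (forall j, rho E j <= j) -> rho E m = m -> rho E k = k -> k < m ->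
  forall j, rep (set_rho E (pred1 m) k) j = if rep E j == m then k else rep E j.
Proof.
move=> le_rho fix_m fix_k lt_km.
apply: (@rep_transfer _ _ (fun j => if j == m then k else j)) => j /=.
- by case: (j =P m) => [->|_ //]; apply: ltnW.
- case: (j =P m) => [->|_]; last by rewrite (rep_iter j 1).
  by rewrite !rep_fix // eqxx ltn_eqF.
- case: (j =P m) => [-> eq_km|]; first by rewrite eq_km ltnn in lt_km.
  by move=> ne_jm /rep_fix->; case: eqP.
Qed.

End Representatives.

(** * Invariants of tables *)

Section Invariants.
Variables (S : choiceType) (R : seq (primary_rel S)).
Implicit Types (E : table (letter S) (pres_rack R)) (i j k l d e : nat).
Implicit Types (y z : letter S) (Q : seq nat) (pend : nat -> letter S -> bool).

(** The invariant of a table inside a coincidence: [pend i y] marks the entries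
    of dead rows that are still to be processed.  Marked rows being dead, the
    live rows that receive a new entry during the processing are not among
    them. *)
Record wf E pend : Prop := Wf {
  wf_rho_le : forall i, rho E i <= i;
  wf_rho_gt0 : forall i, 0 < i -> 0 < rho E i;
  wf_rho_out : forall i, nrows E < i -> rho E i = i;
  wf_rho_tau : forall i, is_row E i -> tau E (rho E i) = tau E i;
  wf_row : forall i y j, act E i y = Some j -> is_row E i;
  wf_sym : forall i y j, act E i y = Some j -> act E j (bar y) = Some i;
  wf_exp : forall i y j, act E i y = Some j -> pr_exp (tau E i) y = tau E j;
  wf_root : forall i y j, act E i y = Some j -> rho E i = i \/ pend i y;
  wf_pend : forall i y, pend i y -> rho E i <> i
}.

(** Inside the processing of [d], the rows of [Q] still have all their letters
    to go, and [d] itself those of [ys]. *)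
Definition pending Q d (ys : seq (letter S)) i y :=
  (i \in Q) || (i == d) && (y \in ys).

Definition no_pending i y := false.

Definition class_edge E i y j := exists i' j',
  [/\ act E i' y = Some j', rep E i' = rep E i & rep E j' = rep E j].

(** The preorder along which the procedure moves.  It asks for class edges
    rather than entries to persist, as coincidences erase entries of live rows
    as well and restore them only up to later identifications. *)
Record extends E E' : Prop := Extends {
  ext_nrows : nrows E <= nrows E';
  ext_tau : forall i, is_row E i -> tau E' i = tau E i;
  ext_rep : forall i j, rep E i = rep E j -> rep E' i = rep E' j;
  ext_act : forall i y j, act E i y = Some j -> class_edge E' i y j
}.

Lemma extends_refl E : extends E E.
Proof. by split=> // i y j Eij; exists i, j. Qed.

Lemma extends_class_edge E E' i y j :
  extends E E' -> class_edge E i y j -> class_edge E' i y j.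
Proof.
move=> ext [i1 [j1 [E1 ri rj]]]; have [i2 [j2 [E2 ri2 rj2]]] := ext_act ext E1.
by exists i2, j2; split; rewrite // ?ri2 ?rj2; apply: ext_rep ext _ _ _.
Qed.

Lemma extends_row E E' i : extends E E' -> is_row E i -> is_row E' i.
Proof. by move=> ext /andP[i0 /leq_trans iE]; rewrite /is_row i0 iE ?ext_nrows. Qed.

Lemma extends_trans E2 E1 E3 : extends E1 E2 -> extends E2 E3 -> extends E1 E3.
Proof.
move=> ext12 ext23; split.
- exact: leq_trans (ext_nrows ext12) (ext_nrows ext23).
- by move=> i iE; rewrite (ext_tau ext23) ?(ext_tau ext12) // (extends_row ext12).
- by move=> i j /(ext_rep ext12) /(ext_rep ext23).
- by move=> i y j /(ext_act ext12); apply: extends_class_edge.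
Qed.

Lemma class_edge_sym E pend i y j :
  wf E pend -> class_edge E i y j -> class_edge E j (bar y) i.
Proof. by move=> wfE [i' [j' [/(wf_sym wfE) E1 ri rj]]]; exists j', i'. Qed.

Section WellFormed.
Variables (E : table (letter S) (pres_rack R)) (pend : nat -> letter S -> bool).
Hypothesis wfE : wf E pend.

Lemma wf_row_r i y j : act E i y = Some j -> is_row E j.
Proof. by move=> /(wf_sym wfE) /(wf_row wfE). Qed.

Lemma wf_rho_row i : is_row E i -> is_row E (rho E i).
Proof.
case/andP=> i0 iE; rewrite /is_row (wf_rho_gt0 wfE) //=.
exact: leq_trans (wf_rho_le wfE i) iE.
Qed.

Lemma wf_rep_row i : is_row E i -> is_row E (rep E i).
Proof. by rewrite /rep => iE; elim: {1}i => //= s; apply: wf_rho_row. Qed.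

Lemma wf_rep_tau i : is_row E i -> tau E (rep E i) = tau E i.
Proof.
move=> iE; suff iter_tau s : is_row E (iter s (rho E) i) /\
    tau E (iter s (rho E) i) = tau E i by case: (iter_tau i).
by elim: s => //= s [jE <-]; split; [apply: wf_rho_row | apply: wf_rho_tau wfE _ _].
Qed.

Lemma wf_rep_root i : rho E (rep E i) = rep E i.
Proof. by case: (repP i (wf_rho_le wfE)). Qed.

Lemma wf_rep_live i : is_row E i -> live E (rep E i).
Proof. by move=> iE; rewrite /live wf_rep_row // wf_rep_root eqxx. Qed.

Lemma wf_weaken pend' :
  (forall i y j, act E i y = Some j -> pend i y -> pend' i y) ->
  (forall i y, pend' i y -> pend i y) -> wf E pend'.
Proof.
move=> sub sub'; case: wfE => le_rho gt0 out rtau row sym exp root dead.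
split=> // i y; last by move=> /sub' /dead.
by move=> j Eij; case: (root i y j Eij); [left | right; apply: sub Eij _].
Qed.

(** The two changes of parents that occur, shortening a chain and linking a
    root, send a set [P] of rows to one common smaller row with the same image
    in the rack. *)
Lemma wf_set_rho (P : pred nat) r pend' :
  (forall j, P j -> [/\ is_row E j, 0 < r, r <= j & tau E r = tau E j]) ->
  (forall i y j, act E i y = Some j -> rho E i = i -> P i -> i = r \/ pend' i y) ->
  (forall i y, pend i y -> pend' i y) ->
  (forall i y, pend' i y -> if P i then r <> i else rho E i <> i) ->
  wf (set_rho E P r) pend'.
Proof.
case: wfE => le_rho gt0 out rtau row sym exp root dead Pr Pact sub pdead.
split=> //=.
- by move=> i; case: ifP => // /Pr[].
- by move=> i i0; case: ifP => [/Pr[]//|_]; apply: gt0.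
- by move=> i iE; case: ifP => [/Pr[/andP[_]]|_]; [rewrite leqNgt iE | apply: out].
- by move=> i iE; case: ifP => [/Pr[]//|_]; apply: rtau.
- move=> i y j Eij; case: (root _ _ _ Eij) => [fix_i|/sub]; last by right.
  case: ifP => [Pi|_]; last by left.
  by case: (Pact _ _ _ Eij fix_i Pi) => [->|]; [left | right].
- by move=> i y /pdead; case: ifP.
Qed.

Lemma wf_update i : is_row E i -> wf (update E i) pend.
Proof.
move=> iE; have le_rho := wf_rho_le wfE; have [fix_r _ min_r] := repP i le_rho.
have orb j : j \in rho_orbit E i -> rep E j = rep E i.
  by case/rho_orbitP=> // t ->; apply: rep_iter.
apply: wf_set_rho => //.
- move=> j Pj; case/rho_orbitP: (Pj) => // t jE.
  have rowj: is_row E j by rewrite jE; elim: t {jE} => //= t; apply: wf_rho_row.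
  split=> //; first by case/andP: (wf_rep_row iE).
    by rewrite jE.
  by rewrite -(orb j Pj) wf_rep_tau.
- by move=> j y k _ /rep_fix fix_j /orb eq_r; left; rewrite -eq_r fix_j.
- move=> j y /(wf_pend wfE) dead_j; case: ifP => // Pj eq_j; apply: dead_j.
  by rewrite -eq_j.
Qed.

Lemma act_deduction k y l i z j :
  act (deduction E k y l) i z = Some j ->
  [\/ [/\ i = l, z = bar y & j = k], [/\ i = k, z = y & j = l]
    | act E i z = Some j].
Proof.
rewrite /=; case: andP => [[/eqP-> /eqP->] [->]|_]; first by constructor 1.
by case: andP => [[/eqP-> /eqP->] [->]|_]; [constructor 2 | constructor 3].
Qed.

Lemma bar_neq y : (y == bar y) = false.
Proof. by case: y => a []; apply/eqP. Qed.

Lemma act_deductionl k y l : act (deduction E k y l) k y = Some l.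
Proof. by rewrite /= bar_neq andbF !eqxx. Qed.

Lemma act_deductionr k y l : act (deduction E k y l) l (bar y) = Some k.
Proof. by rewrite /= !eqxx. Qed.

(** An undefined pair of cells can be filled by an edge between live rows
    without overwriting anything; the two cells differ since [y] is not its own
    inverse. *)
Lemma wf_deduction k y l :
  live E k -> live E l -> act E k y = None -> act E l (bar y) = None ->
  pr_exp (tau E k) y = tau E l ->
  wf (deduction E k y l) pend /\ extends E (deduction E k y l).
Proof.
move=> /andP[kE /eqP fix_k] /andP[lE /eqP fix_l] Eky Ely tau_kl.
have old i z j : act E i z = Some j -> act (deduction E k y l) i z = Some j.
  rewrite /=; case: andP => [[/eqP-> /eqP->]|_]; first by rewrite Ely.
  by case: andP => [[/eqP-> /eqP->]|//]; rewrite Eky.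
split; last by split=> // i z j /old Eij; exists i, j.
case: wfE => le_rho gt0 out rtau row sym exp root dead.
split=> // i z j /act_deduction.
- by case=> [[-> _ _]|[-> _ _]|/row].
- case=> [[-> -> ->]|[-> -> ->]|/sym/old //].
    by rewrite barK; apply: act_deductionl.
  exact: act_deductionr.
- by case=> [[-> -> ->]|[-> -> ->]|/exp //]; rewrite /= -?tau_kl ?pr_expK.
- by case=> [[-> _ _]|[-> _ _]|/root //]; left.
Qed.

Lemma act_undefine d x e i z :
  act (undefine E d x e) i z =
  if (i == e) && (z == bar x) || (i == d) && (z == x) then None else act E i z.
Proof. by rewrite /=; case: andP => //=; case: andP. Qed.

Lemma wf_undefine d x e : act E d x = Some e -> wf (undefine E d x e) pend.
Proof.
move=> Edx; have sub i z j : act (undefine E d x e) i z = Some j -> act E i z = Some j.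
  by rewrite act_undefine; case: ifP.
case: wfE => le_rho gt0 out rtau row sym exp root dead.
split=> // i z j Eij; try by have := sub _ _ _ Eij; eauto.
have Eji := sym _ _ _ (sub _ _ _ Eij); rewrite act_undefine.
case: ifP => // /orP[]/andP[/eqP jE /eqP zE]; move: Eij Eji; rewrite jE.
  have{zE} -> : z = x by apply: can_inj (@barK S) _ _ zE.
  rewrite (sym _ _ _ Edx) => + [iE].
  by rewrite -iE act_undefine !eqxx orbT.
have {zE} -> : z = bar x by rewrite -zE barK.
by rewrite barK Edx => + [iE]; rewrite -iE act_undefine !eqxx.
Qed.

End WellFormed.

(** * Coincidences *)

(** Linking two roots keeps the entries of the root that dies, so the invariant
    survives because that root joins the queue. *)
Lemma wf_merge E Q d ys m k E' Q' :
  wf E (pending Q d ys) -> is_row E m -> is_row E k -> tau E m = tau E k ->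
  Defs.merge (E, Q) m k = (E', Q') ->
  [/\ wf E' (pending Q' d ys), extends E E', act E' = act E
    & rep E' m = rep E' k].
Proof.
move=> wfE mE kE tau_mk; rewrite /Defs.merge.
case: eqP => [eq_mk [<- <-]|/eqP ne_mk [<- <-]].
  by split=> //; apply: extends_refl.
set mu := rep E m in ne_mk *; set nu := rep E k in ne_mk *.
have le_rho := wf_rho_le wfE.
have fix_mu : rho E mu = mu := wf_rep_root wfE m.
have fix_nu : rho E nu = nu := wf_rep_root wfE k.
have muE : is_row E mu := wf_rep_row wfE mE.
have nuE : is_row E nu := wf_rep_row wfE kE.
have tau_mu : tau E mu = tau E nu by rewrite !(wf_rep_tau wfE).
have fix_max : rho E (maxn mu nu) = maxn mu nu by case: leqP.
have fix_min : rho E (minn mu nu) = minn mu nu by case: leqP.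
have lt_minmax : minn mu nu < maxn mu nu by move: ne_mk; case: (ltngtP mu nu).
have rep' := rep_redirect le_rho fix_max fix_min lt_minmax.
split=> //; last first.
- rewrite !rep' -/mu -/nu; case: (ltngtP mu nu) ne_mk => //= lt_mn _.
    by rewrite eqxx ltn_eqF.
  by rewrite eqxx ltn_eqF.
- split=> //; first by move=> i j eq_ij; rewrite !rep' eq_ij.
  by move=> i y j Eij; exists i, j.
apply: (wf_set_rho wfE) => /=.
- move=> j /eqP->; split; first by case: leqP.
  + by case: (leqP mu nu) => _; [case/andP: muE | case/andP: nuE].
  + exact: ltnW.
  + by case: leqP.
- by move=> i y j _ _ /eqP->; right; rewrite /pending mem_rcons inE eqxx.
- by move=> i y; rewrite /pending mem_rcons inE => /orP[->|->]; rewrite !orbT.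
- move=> i y; rewrite /pending mem_rcons inE -orbA.
  case: eqP => [-> _ eq_m|_ /=]; first by rewrite eq_m ltnn in lt_minmax.
  exact: wf_pend wfE _ _.
Qed.

(** The edge from [d] to [e] is erased and reappears between the classes of
    [d] and [e]: either it is put between the representatives [delta] and [eps],
    or one of them already has an edge with the same label and the merge
    identifies the far end of that edge with the other representative.  Row [d]
    regains no entry, as [delta] and [eps] are live and [d] is dead. *)
Lemma wf_process_letter d x ys E Q E' Q' :
  wf E (pending Q d (x :: ys)) -> process_letter d (E, Q) x = (E', Q') ->
  wf E' (pending Q' d ys) /\ extends E E'.
Proof.
move=> wfE; rewrite /process_letter.
have sub_pend i y : pending Q d ys i y -> pending Q d (x :: ys) i y.
  by rewrite /pending inE => /orP[->|/andP[-> ->]] //; rewrite !orbT.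
case Edx: (act E d x) => [e|]; last first.
  case=> <- <-; split; last exact: extends_refl.
  apply: wf_weaken wfE _ _ _ => // i y j Eij; rewrite /pending inE.
  by case: eqP => [y_x|//]; case: eqP => [i_d|//]; rewrite -i_d -y_x Eij in Edx.
have dE := wf_row wfE Edx; have eE := wf_row_r wfE Edx.
set E1 := undefine E d x e.
have wf1 : wf E1 (pending Q d ys).
  apply: wf_weaken (wf_undefine wfE Edx) _ _ _ => // i y j.
  rewrite act_undefine /pending inE; case: ifP => // /negbT/norP[_ ne_dx] _.
  case/orP=> [->//|/andP[i_d /orP[y_x|->]]]; last by rewrite i_d orbT.
  by rewrite i_d y_x in ne_dx.
set delta := rep E1 d; set E2 := update E1 d; set eps := rep E2 e.
set E3 := update E2 e => step.
have [le_rho2 rep2] := rep_update d (wf_rho_le wf1 : forall j, rho E1 j <= j).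
have [_ rep32] := rep_update e le_rho2.
have wf3 : wf E3 (pending Q d ys) by rewrite /E3 /E2; do 2!apply: wf_update => //.
have rep3 i : rep E3 i = rep E i by rewrite rep32 rep2.
have delta3 : delta = rep E3 d by rewrite rep3.
have eps3 : eps = rep E3 e by rewrite rep32.
have live_delta : live E3 delta by rewrite delta3 (wf_rep_live wf3).
have live_eps : live E3 eps by rewrite eps3 (wf_rep_live wf3).
have rep_delta : rep E3 delta = rep E3 d.
  by rewrite delta3 rep_idem //; apply: wf_rho_le wf3.
have rep_eps : rep E3 eps = rep E3 e.
  by rewrite eps3 rep_idem //; apply: wf_rho_le wf3.
have tau_de : pr_exp (tau E3 delta) x = tau E3 eps.
  by rewrite delta3 eps3 !(wf_rep_tau wf3) //; apply: wf_exp wfE _ _ _ Edx.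
(* Only the class edge between d and e is at stake: everything else is
   inherited from E3, whose classes are those of E. *)
have done_ F P : wf F (pending P d ys) -> extends E3 F -> class_edge F d x e ->
    wf F (pending P d ys) /\ extends E F.
  move=> wfF ext3 Fde; split=> //; split.
  - exact: ext_nrows ext3.
  - exact: ext_tau ext3.
  - by move=> i j eq_ij; apply: ext_rep ext3 _ _ _; rewrite !rep3.
  move=> i y j Eij; have [/orP[]/andP[/eqP i_e /eqP y_x]|/negbTE keep] :=
    boolP ((i == e) && (y == bar x) || (i == d) && (y == x)).
  - move: Eij; rewrite i_e y_x (wf_sym wfE Edx) => - [<-].
    exact: class_edge_sym wfF Fde.
  - by move: Eij; rewrite i_e y_x Edx => - [<-].
  - apply: ext_act ext3 _ _ _ _.
    rewrite -[act E3 i y]/(act (undefine E d x e) i y).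
    by rewrite act_undefine keep.
move: step; case Edk: (act E3 delta x) => [k|].
  have tau_k : tau E3 eps = tau E3 k by rewrite -tau_de (wf_exp wf3 Edk).
  case/(wf_merge wf3 _ (wf_row_r wf3 Edk) tau_k); first by case/andP: live_eps.
  move=> wf' ext3 act' rep_k; apply: done_ => //; exists delta, k.
  by rewrite act' -rep_k; split=> //; apply: ext_rep ext3 _ _ _.
case Eek: (act E3 eps (bar x)) => [k|].
  have tau_k : tau E3 delta = tau E3 k.
    by rewrite -(wf_exp wf3 Eek) -tau_de pr_expK.
  case/(wf_merge wf3 _ (wf_row_r wf3 Eek) tau_k); first by case/andP: live_delta.
  move=> wf' ext3 act' rep_k; apply: done_ => //; exists k, eps.
  rewrite act' -rep_k; split; last by apply: ext_rep ext3 _ _ _.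
    by rewrite -[x]barK; apply: wf_sym wf3 _ _ _ Eek.
  by apply: ext_rep ext3 _ _ _.
case=> <- <-; have [wf' ext3] := wf_deduction wf3 live_delta live_eps Edk Eek tau_de.
apply: done_ => //; exists delta, eps.
by rewrite act_deductionl; split=> //; apply: ext_rep ext3 _ _ _.
Qed.

Variable Y : seq (letter S).
Hypothesis Y_full : forall y, y \in Y.

Lemma wf_process_letters d ys E Q E' Q' :
  wf E (pending Q d ys) -> foldl (process_letter d) (E, Q) ys = (E', Q') ->
  wf E' (pending Q' d [::]) /\ extends E E'.
Proof.
elim: ys E Q => [|x ys IH] E Q wfE.
  by move=> /= [<- <-]; split=> //; apply: extends_refl.
rewrite -[foldl _ _ _]/(foldl (process_letter d) (process_letter d (E, Q) x) ys).
case step: (process_letter d (E, Q) x) => [E1 Q1].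
have [wf1 ext1] := wf_process_letter wfE step.
by move=> /(IH _ _ wf1)[wf' ext']; split=> //; apply: extends_trans ext1 ext'.
Qed.

Lemma wf_process_queue fuel E Q d E' :
  wf E (pending Q d [::]) -> process_queue Y fuel (E, Q) = Some E' ->
  wf E' no_pending /\ extends E E'.
Proof.
elim: fuel E Q d => [|f IH] E [|q Q] d wfE //=.
1,2: by case=> <-; split; [|exact: extends_refl];
  apply: wf_weaken wfE _ _ _ => // i y j _; rewrite /pending andbF.
case step: (foldl _ _ _) => [E1 Q1].
have wfq : wf E (pending Q q Y).
  apply: wf_weaken wfE _ _ _ => [i y j _|i y]; rewrite /pending inE andbF Y_full.
    by rewrite andbT orbF orbC.
  by rewrite andbT orbF orbC.
have [wf1 ext1] := wf_process_letters wfq step.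
by move=> /(IH _ _ _ wf1)[wf' ext']; split=> //; apply: extends_trans ext1 ext'.
Qed.

Lemma wf_coincidence fuel E m k E' :
  wf E no_pending -> is_row E m -> is_row E k -> tau E m = tau E k ->
  coincidence Y fuel E m k = Some E' -> wf E' no_pending /\ extends E E'.
Proof.
move=> wfE mE kE tau_mk; rewrite /coincidence.
have wf0 : wf E (pending [::] 0 [::]).
  by apply: wf_weaken wfE _ _ _ => // i y; rewrite /pending andbF.
case step: (Defs.merge _ _ _) => [E1 Q1].
have [wf1 ext1 _ _] := wf_merge wf0 mE kE tau_mk step.
by move=> /(wf_process_queue wf1)[wf' ext']; split=> //; apply: extends_trans ext1 ext'.
Qed.

(** Coincidences create no rows; hence no row appears whose link to the
    generators would have to be justified. *)
Lemma nrows_process_letter d EQ x :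
  nrows (process_letter (S := S) (T := pres_rack R) d EQ x).1 = nrows EQ.1.
Proof.
case: EQ => E Q; rewrite /process_letter; case: (act E d x) => [e|] //.
by do 2?[case: (act _ _ _) => [k|]]; rewrite /Defs.merge //=; case: eqP.
Qed.

Lemma nrows_process_queue fuel EQ E' :
  process_queue (T := pres_rack R) Y fuel EQ = Some E' -> nrows E' = nrows EQ.1.
Proof.
elim: fuel EQ => [|f IH] [E [|d Q]] //=; try by case=> <-.
move=> /IH->; set EQ1 := (E, Q); rewrite -[nrows E]/(nrows EQ1.1).
elim: Y EQ1 => //= x ys IHys EQ1; by rewrite IHys nrows_process_letter.
Qed.

Lemma nrows_coincidence fuel E m k E' :
  coincidence Y fuel E m k = Some E' -> nrows E' = nrows E.
Proof. by move=> /nrows_process_queue->; rewrite /Defs.merge; case: eqP. Qed.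

(** * Definitions and scans *)

Lemma wf_live E i y j : wf E no_pending -> act E i y = Some j -> live E j.
Proof.
move=> wfE Eij; rewrite /live (wf_row_r wfE Eij).
by case: (wf_root wfE (wf_sym wfE Eij)) => // ->; rewrite eqxx.
Qed.

Lemma is_row_add_row E t i :
  is_row (add_row E t) i -> is_row E i \/ i = (nrows E).+1.
Proof. by rewrite /is_row /= (leq_eqVlt i) ltnS => /andP[-> /orP[/eqP|]]; auto. Qed.

Lemma wf_add_row E pend t : wf E pend ->
  wf (add_row E t) pend /\ extends E (add_row E t).
Proof.
move=> wfE; set N := (nrows E).+1.
have rhoE : rho (add_row E t) =1 rho E.
  by move=> i /=; case: eqP => // ->; rewrite (wf_rho_out wfE).
have tauE i : is_row E i -> tau (add_row E t) i = tau E i.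
  by move=> /andP[_ iE] /=; rewrite ltn_eqF.
split; last first.
  split=> //; first by move=> i j; rewrite !(eq_rep rhoE).
  by move=> i y j Eij; exists i, j.
split.
- by move=> i; rewrite rhoE; apply: wf_rho_le wfE _.
- by move=> i; rewrite rhoE; apply: wf_rho_gt0 wfE _.
- by move=> i /ltnW lt_i; rewrite rhoE; apply: wf_rho_out wfE _ lt_i.
- move=> i; rewrite rhoE; case/is_row_add_row => [iE|->].
    by rewrite !tauE ?(wf_rho_row wfE) // (wf_rho_tau wfE).
  by rewrite (wf_rho_out wfE).
- move=> i y j /(wf_row wfE) /andP[i0 iE].
  by rewrite /is_row i0 (leq_trans iE) /=.
- exact: wf_sym wfE.
- move=> i y j; rewrite -[act _ _ _]/(act E i y) => Eij.
  have [iE jE] := (wf_row wfE Eij, wf_row_r wfE Eij).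
  by rewrite !tauE // (wf_exp wfE Eij).
- by move=> i y j; rewrite rhoE; apply: wf_root wfE _ _ _.
- by move=> i y; rewrite rhoE; apply: wf_pend wfE _ _.
Qed.

Lemma wf_define E pend i y :
  wf E pend -> live E i -> act E i y = None ->
  [/\ wf (define E i y) pend, extends E (define E i y),
      act (define E i y) i y = Some (nrows E).+1
    & forall j, live E j -> live (define E i y) j].
Proof.
move=> wfE live_i Eiy; rewrite /define.
set N := (nrows E).+1; set t := pr_exp _ _.
have [wf0 ext0] := wf_add_row t wfE.
have live0 j : live E j -> live (add_row E t) j.
  case/andP=> jE fix_j; rewrite /live (extends_row ext0) //=.
  by case/andP: jE => _ jE; rewrite (ltn_eqF (jE : j < N)).
have live_N : live (add_row E t) N by rewrite /live /is_row /= leqnn !eqxx.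
have act_N z : act E N z = None.
  by case ENz: (act E N z) => [k|//]; have := wf_row wfE ENz; rewrite /is_row ltnn andbF.
have tau_iN : pr_exp (tau (add_row E t) i) y = tau (add_row E t) N.
  by rewrite (ext_tau ext0) /= ?eqxx //; case/andP: live_i.
have [wf1 ext1] := wf_deduction wf0 (live0 _ live_i) live_N Eiy (act_N _) tau_iN.
split=> //; first exact: extends_trans ext0 ext1.
exact: act_deductionl.
Qed.

(** A scan loop stops at an undefined entry, and what remains unread is a suffix
    of the word; for the backward loop, which reads the inverse word, the
    remainder is thus a prefix of what the forward loop had left, beginning at
    the same undefined entry. *)
Lemma wf_follow E k v k' v1 :
  wf E no_pending -> live E k -> follow E k v = (k', v1) ->
  [/\ live E k', word_act (tau E k') v1 = word_act (tau E k) v,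
      forall y v2, v1 = y :: v2 -> act E k' y = None
    & exists p, v = p ++ v1].
Proof.
move=> wfE; elim: v k => [|y v IH] k live_k /=.
  by case=> <- <-; split=> //; exists [::].
case Eky: (act E k y) => [m|].
  case/(IH _ (wf_live wfE Eky)) => live_k' act_v1 stop [p vE]; split=> //.
    by rewrite (wf_exp wfE Eky).
  by exists (y :: p); rewrite vE.
by case=> <- <-; split=> //; [move=> z v2 [<-] | exists [::]].
Qed.

Variable g : nat.

(** Rows linked to the first [g] rows by entries and identifications.  Working up
    to [rep] makes this stable under [extends]. *)
Inductive conn E : nat -> Prop :=
| ConnGen i of 0 < i <= g : conn E i
| ConnClass i j of conn E i & rep E i = rep E j : conn E j
| ConnEdge i y j of conn E i & act E i y = Some j : conn E j.

Lemma extends_conn E E' j : extends E E' -> conn E j -> conn E' j.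
Proof.
move=> ext; elim=> {j} [i /ConnGen //|i j _ IH /(ext_rep ext)|i y j _ IH /(ext_act ext)].
  exact: ConnClass.
case=> i' [j' [Eij ri rj]]; apply: ConnClass rj; apply: ConnEdge Eij.
exact: ConnClass IH (esym ri).
Qed.

Definition settled E : Prop :=
  wf E no_pending /\ forall j, is_row E j -> conn E j.

Definition evolves E E' : Prop := settled E' /\ extends E E'.

Lemma evolves_trans E2 E1 E3 : evolves E1 E2 -> evolves E2 E3 -> evolves E1 E3.
Proof. by case=> _ ext [? /(extends_trans ext)]. Qed.

Lemma evolves_refl E : settled E -> evolves E E.
Proof. by split=> //; apply: extends_refl. Qed.

Lemma settled_same_rows E E' : settled E -> wf E' no_pending ->
  extends E E' -> nrows E' = nrows E -> evolves E E'.
Proof.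
move=> [wfE connE] wfE' ext eq_n; do 2?split=> //.
by move=> j; rewrite /is_row eq_n => /connE; apply: extends_conn ext.
Qed.

Lemma evolves_define E i y : settled E -> live E i -> act E i y = None ->
  evolves E (define E i y).
Proof.
move=> [wfE connE] live_i Eiy.
have [wf' ext act_i _] := wf_define wfE live_i Eiy; do 2?split=> //.
move=> j jE; have [/connE|->] := is_row_add_row (t := tau E i) jE.
  exact: extends_conn ext.
apply: ConnEdge act_i; apply: extends_conn ext _; apply: connE.
by case/andP: live_i.
Qed.

(** The unread word always sends the image of the forward row to that of the
    backward row.  When it is empty the two rows have the same image, which
    justifies the coincidence; when it is a letter it justifies the
    deduction. *)
Lemma evolves_scan fuel E k v l E' :
  settled E -> live E k -> live E l -> word_act (tau E k) v = tau E l ->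
  scan Y fuel E k v l = Some E' -> evolves E E'.
Proof.
elim: fuel E k v l => //= f IH E k v l setE live_k live_l act_v.
have [wfE _] := setE.
case Fk: (follow E k v) => [k' v1].
have [live_k' act_v1 stop_k _] := wf_follow wfE live_k Fk.
case Fl: (follow E l (winv v1)) => [l' v2].
have [live_l' act_v2 stop_l [p v1E]] := wf_follow wfE live_l Fl.
have act_v' : word_act (tau E k') (winv v2) = tau E l'.
  by rewrite -[RHS](word_actK _ v2) act_v2 -act_v -act_v1 word_actK.
have {stop_k} stop_k y v' : winv v2 = y :: v' -> act E k' y = None.
  move=> v2E; apply: (stop_k y (v' ++ winv p)).
  by rewrite -[v1]winvK v1E /winv map_cat rev_cat -/(winv _) v2E.
have {stop_l} stop_l y : winv v2 = [:: y] -> act E l' (bar y) = None.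
  by move=> v2E; apply: (stop_l _ [::]); rewrite -[v2]winvK v2E.
case v'E: (winv v2) act_v' => [|y [|z v']] act_v'.
- case: eqP => [_ [<-]|_ coinc]; first exact: evolves_refl.
  have [k'E _] := andP live_k'; have [l'E _] := andP live_l'.
  have [wf' ext'] := wf_coincidence wfE k'E l'E act_v' coinc.
  exact: settled_same_rows setE wf' ext' (nrows_coincidence coinc).
- case=> <-.
  have [wf' ext'] := wf_deduction wfE live_k' live_l' (stop_k _ _ v'E)
    (stop_l _ v'E) act_v'.
  exact: settled_same_rows.
- have [_ ext1 _ live1] := wf_define wfE live_k' (stop_k _ _ v'E).
  have ev1 := evolves_define setE live_k' (stop_k _ _ v'E).
  move=> scanE; apply: (evolves_trans ev1); apply: IH scanE; auto.
    by case: ev1.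
  have [k'E _] := andP live_k'; have [l'E _] := andP live_l'.
  by rewrite !(ext_tau ext1).
Qed.

(** * The main loop *)

Lemma evolves_scan_secondary fuel E i ws E' :
  settled E ->
  (forall w, w \in ws -> forall t : pres_rack R, word_act t (fg_word w) = t) ->
  scan_secondary Y fuel E i ws = Some E' -> evolves E E'.
Proof.
elim: ws E => [|w ws IH] E setE act_ws /=; first by case=> <-; apply: evolves_refl.
case: ifP => [live_i|_ [<-]]; last exact: evolves_refl.
case scanE: (scan _ _ _ _ _ _) => [E1|//] /= step.
have act_w := act_ws w (mem_head _ _) (tau E i).
have ev1 := evolves_scan setE live_i live_i act_w scanE.
apply: (evolves_trans ev1); apply: IH step; first by case: ev1.
by move=> u ws_u; apply: act_ws; rewrite inE ws_u orbT.
Qed.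

Definition class_total E i : Prop := forall y, exists j, class_edge E i y j.

Lemma extends_class_total E E' i :
  extends E E' -> class_total E i -> class_total E' i.
Proof. by move=> ext tot y; have [j /(extends_class_edge ext)] := tot y; exists j. Qed.

Lemma class_total_rep E i j : rep E i = rep E j -> class_total E i -> class_total E j.
Proof.
move=> eq_ij tot y; have [m [i' [m' [E1 ri rm]]]] := tot y.
by exists m, i', m'; rewrite -eq_ij.
Qed.

Lemma evolves_fill_row E i : settled E ->
  evolves E (fill_row Y E i) /\ (live E i -> class_total (fill_row Y E i) i).
Proof.
move=> setE; rewrite /fill_row; case: ifP => live_i; last first.
  by split=> //; apply: evolves_refl.
suff fill ys : let E' := foldl (fun E' y => if act E' i y is None
      then define E' i y else E') E ys in
    evolves E E' /\ forall y, y \in ys -> exists j, class_edge E' i y j.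
  by have [ev tot] := fill Y; split=> // _ y; apply: tot.
elim: ys E setE live_i => [|y ys IH] E setE live_i.
  by split=> //; apply: evolves_refl.
rewrite /=; set E1 := match act E i y with None => _ | _ => _ end.
have [ev1 live1 [j E1j]] :
    [/\ evolves E E1, live E1 i & exists j, act E1 i y = Some j].
  rewrite /E1; case Eiy: (act E i y) => [j|].
    by split=> //; [apply: evolves_refl | exists j].
  have [wfE _] := setE; have [_ _ act_i live1] := wf_define wfE live_i Eiy.
  by split; [apply: evolves_define | apply: live1 | exists (nrows E).+1].
have [ev' tot'] := IH E1 (proj1 ev1) live1; split; first exact: evolves_trans ev1 ev'.
move=> z; rewrite inE => /orP[/eqP->|]; last exact: tot'.
by exists j; apply: extends_class_edge (proj2 ev') _; exists i, j.
Qed.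

Lemma live_le_max E i : live E i -> i <= max_live E.
Proof.
move=> live_i; apply: (@leq_bigmax_seq _ (index_iota 1 (nrows E).+1) (live E) id) => //.
by rewrite mem_index_iota; case/andP: live_i.
Qed.

Lemma max_live_le E : max_live E <= nrows E.
Proof. by apply/bigmax_leqP_seq => i; rewrite mem_index_iota => /andP[]. Qed.

(** A row that is dead when the loop reaches it has a smaller representative,
    already treated, and shares its class edges. *)
Lemma evolves_main_loop R2 fuel M E i E' :
  (forall w, w \in R2 -> forall t : pres_rack R, word_act t (fg_word w) = t) ->
  settled E -> 0 < i -> (forall c, 0 < c < i -> class_total E c) ->
  main_loop R2 Y fuel M E i = Some (Completed E') ->
  evolves E E' /\ forall c, live E' c -> class_total E' c.
Proof.
move=> act_R2; elim: fuel E i => [|f IH] E i setE i0 tot /=; case: ifP => //.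
1,3: move=> _ []; case: ltnP => // lt_max [<-]; split; first exact: evolves_refl.
1,2: by move=> c live_c; apply: tot; have /andP[/andP[-> _] _] := live_c;
  apply: leq_ltn_trans lt_max; apply: live_le_max.
case/andP=> le_i _.
case scanE: (scan_secondary _ _ _ _ _) => [E1|//] /= loop.
have ev1 := evolves_scan_secondary setE act_R2 scanE.
have [ev2 tot_i] := evolves_fill_row i (proj1 ev1).
have ext1 := proj2 ev1; have ext2 := proj2 ev2.
have [[wf1 _] _] := ev1.
have [|ev3 tot'] := IH _ _ (proj1 ev2) (ltn0Sn i) _ loop; last first.
  by split=> //; apply: evolves_trans ev1 (evolves_trans ev2 ev3).
move=> c /andP[c0]; rewrite ltnS leq_eqVlt => /orP[/eqP->|lt_ci]; last first.
  apply: extends_class_total ext2 _; apply: extends_class_total ext1 _.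
  by apply: tot; rewrite c0.
have [|dead_i] := boolP (live E1 i); first exact: tot_i.
have iE : is_row E1 i.
  rewrite (extends_row ext1) // /is_row i0.
  exact: leq_trans le_i (max_live_le E).
have le_rho := wf_rho_le wf1; have [fix_r _ /(_ 1) le_r] := repP i le_rho.
have lt_ri : rep E1 i < i.
  apply: leq_ltn_trans le_r _; rewrite ltn_neqAle le_rho andbT.
  by move: dead_i; rewrite /live iE.
apply: extends_class_total ext2 _; apply: (@class_total_rep _ (rep E1 i)).
  exact: rep_idem.
apply: extends_class_total ext1 _; apply: tot; rewrite lt_ri andbT.
by have /andP[] := wf_rep_row wf1 iE.
Qed.

(** * Reading off the properties of a settled table *)

Lemma trace_cons E i y w :
  trace E i (y :: w) = obind (fun k => trace E k w) (act E i y).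
Proof.
by rewrite /trace /=; case: (act E i y) => //=; elim: w.
Qed.

(** Stepping along [y] and back along its inverse returns to the same row, by
    the symmetry of the entries. *)
Lemma trace_reduce E pend i w j :
  wf E pend -> trace E i w = Some j -> trace E i (reduce w) = Some j.
Proof.
move=> wfE; elim: w i => //= y w IH i.
rewrite trace_cons; case Eiy: (act E i y) => [k|//] /= /IH.
case: (reduce w) => [|z u] /=; first by rewrite trace_cons Eiy.
case: eqP => [->|_]; last by rewrite [trace E i _]trace_cons Eiy.
by rewrite trace_cons (wf_sym wfE Eiy).
Qed.

Lemma live_rep E i : live E i -> rep E i = i.
Proof. by case/andP=> _ /eqP /rep_fix. Qed.

(** With nothing pending, rows bearing entries are live, and a live row is the
    only live row of its class. *)
Lemma settled_class_edge E i y j :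
  wf E no_pending -> live E i -> class_edge E i y j -> exists k, act E i y = Some k.
Proof.
move=> wfE /live_rep ri [i' [k [Eik ri' _]]]; exists k.
suff -> : i = i' by [].
have [/rep_fix <- //|//] := wf_root wfE Eik; by rewrite ri' ri.
Qed.

(** A link through identifications becomes a path of entries once each row is
    replaced by its representative; that of a generator row is a smaller row,
    hence again a generator row. *)
Lemma conn_trace E j : wf E no_pending -> g <= nrows E -> conn E j ->
  exists i (w : free_group S),
    [/\ live E i, 0 < i <= g & trace E i w = Some (rep E j)].
Proof.
move=> wfE leg; suff ex_w : conn E j -> exists i w,
    [/\ live E i, 0 < i <= g & trace E i w = Some (rep E j)].
  case/ex_w=> i [w [live_i ig tr]]; exists i, (fg_reduce w); split=> //.
  exact: trace_reduce wfE tr.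
elim=> {j} [i /andP[i0 ig]|i j _ IH <- //|i y j _ [i0 [w [live0 i0g tr]]] Eij].
  have iE : is_row E i by rewrite /is_row i0 (leq_trans ig).
  exists (rep E i), [::]; split=> //; first exact: wf_rep_live wfE _ iE.
  case/andP: (wf_rep_row wfE iE) => -> _; apply: leq_trans ig.
  by have [_ _ /(_ 0)] := repP i (wf_rho_le wfE).
exists i0, (rcons w y); split=> //.
rewrite /trace foldl_rcons -/(trace E i0 w) tr /=.
rewrite (live_rep (wf_live wfE Eij)) -Eij; congr act.
by apply: live_rep; apply: wf_live wfE (wf_sym wfE Eij).
Qed.

End Invariants.

Section Enumerate.
Variables (n : nat) (R : seq (primary_rel 'I_n.+1)) (Y : seq (letter 'I_n.+1)).
Hypothesis Y_full : forall y, y \in Y.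

Lemma settled_init : settled n.+1 (init R).
Proof. by split=> [|j /ConnGen //]; split. Qed.

Lemma extends_init_gen E (a : 'I_n.+1) : extends (init R) E ->
  is_row E (gen_row a) /\ tau E (gen_row a) = pr_gen R a.
Proof.
move=> ext; have aE : is_row (init R) (gen_row a) by rewrite /is_row /= ltn_ord.
by rewrite (extends_row ext) // (ext_tau ext) //= inord_val.
Qed.

Lemma evolves_scan_primary fuel E rs E' :
  settled n.+1 E -> extends (init R) E -> {subset rs <= R} ->
  scan_primary Y fuel E rs = Some E' -> evolves n.+1 E E'.
Proof.
elim: rs E => [|[[a u] b] rs IH] E setE ext0 sub /=.
  by case=> <-; apply: evolves_refl.
case scanE: (scan _ _ _ _ _ _) => [E1|//] /= step.
have [[aE tau_a] [bE tau_b]] := (extends_init_gen a ext0, extends_init_gen b ext0).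
have [wfE _] := setE.
have act_u : word_act (tau E (rep E (gen_row a))) u = tau E (rep E (gen_row b)).
  rewrite !(wf_rep_tau wfE) // tau_a tau_b; apply: word_act_primary.
  exact/sub/mem_head.
have ev1 := evolves_scan Y_full setE (wf_rep_live wfE aE) (wf_rep_live wfE bE)
  act_u scanE.
apply: (evolves_trans ev1); apply: IH step; first by case: ev1.
  by apply: extends_trans ext0 _; case: ev1.
by move=> r rs_r; apply: sub; rewrite inE rs_r orbT.
Qed.

End Enumerate.

Theorem theorem3p6 (n : nat) (R : seq (primary_rel 'I_n.+1))
    (R2 : seq (free_group 'I_n.+1)) (Y : seq (letter 'I_n.+1)) (M : nat)
    (E : table (letter 'I_n.+1) (pres_rack R)) :
  uniq R ->
  uniq R2 -> (forall w, w \in R2 <-> exists2 r, r \in R & w = secondary_rel r) ->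
  uniq Y -> (forall y, y \in Y) ->
  0 < M ->
  completes R2 Y M E ->
  is_table E /\
  complete E /\
  (live E 1 /\ forall a : 'I_n.+1, tau E (gen_row a) = pr_gen R a) /\
  (forall i j y, is_row E i -> is_row E j ->
     (act E i y = Some j <-> act E j (bar y) = Some i)) /\
  (forall i j y, is_row E i -> is_row E j -> act E i y = Some j ->
     pr_exp (tau E i) y = tau E j) /\
  (forall j, live E j ->
     exists i (w : free_group 'I_n.+1),
       [/\ live E i, 1 <= i <= n.+1 & trace E i w = Some j]) /\
  (forall i, is_row E i -> tau E i = tau E (rep E i)).
Proof.
move=> _ _ R2E _ Y_full _ [fuel]; rewrite /enumerate.
case prim: (scan_primary _ _ _ _) => [E0|//] /= loop.
have ev0 : evolves n.+1 (init R) E0.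
  exact: evolves_scan_primary (settled_init R) (extends_refl _) _ prim.
have act_R2 w : w \in R2 -> forall t : pres_rack R, word_act t (fg_word w) = t.
  by case/R2E=> r Rr -> t; apply: word_act_secondary.
have tot0 c : 0 < c < 1 -> class_total E0 c by case: c.
have [ev1 tot] := evolves_main_loop Y_full act_R2 (proj1 ev0) (ltn0Sn 0) tot0 loop.
have [[wfE connE] ext] := evolves_trans ev0 ev1.
have rowE i y j : act E i y = Some j -> is_row E i /\ is_row E j.
  by move=> Eij; split; [apply: wf_row wfE _ _ _ Eij | apply: wf_row_r wfE _ _ _ Eij].
split; [|split; [|split; [|split; [|split; [|split]]]]].
- split=> // i iE; split; [exact: wf_rho_row wfE _ iE | exact: wf_rho_le wfE i].
- move=> i y live_i; have [j] := tot i live_i y.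
  exact: settled_class_edge.
- split=> [|a]; last by case: (extends_init_gen a ext).
  have [row1 _] := extends_init_gen ord0 ext; rewrite /live row1 eqn_leq.
  by rewrite (wf_rho_le wfE) (wf_rho_gt0 wfE).
- by move=> i j y _ _; split=> [|] /(wf_sym wfE); rewrite ?barK.
- by move=> i j y _ _; apply: wf_exp wfE _ _ _.
- move=> j live_j; have [jE _] := andP live_j.
  by rewrite -(live_rep live_j); apply: conn_trace wfE (ext_nrows ext) (connE j jE).
- by move=> i iE; rewrite (wf_rep_tau wfE).
Qed.
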